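(* Let $d$ be a positive integer and suppose that $-1\le\beta<\alpha<1$ and $\beta<0$. If $$\frac{1-\beta}{\alpha-\beta}>\sqrt{\left\lfloor\frac{d+2-k}{2}\right\rfloor\left\lceil\frac{d+2-k}{2}\right\rceil}$$ for an integer $k$ with $0\le k\le d+1$, then $$N_{\alpha,\beta}(d)\le 2^k(d+2-k)-1.$$
   Context: For $-1\le\beta<\alpha<1$, a spherical $\{\alpha,\beta\}$-code in $\mathbb{R}^d$ is a set $S$ of unit vectors in $\mathbb{R}^d$ such that $x^\top y\in\{\alpha,\beta\}$ for any two distinct $x,y\in S$ (it is allowed that only one of the values occurs), and $N_{\alpha,\beta}(d)$ is the maximum size of such a code. *)

(* Defs.v *)
From HB Require Import structures.
From mathcomp Require Import all_boot all_order all_algebra.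
From mathcomp Require Import all_classical all_reals all_analysis.
Set Implicit Arguments.
Unset Strict Implicit.
Unset Printing Implicit Defensive.
Import Order.TTheory GRing.Theory Num.Theory.
Local Open Scope classical_set_scope.
Local Open Scope ring_scope.

Definition dotv (R : realType) (d : nat) (x y : 'cV[R]_d) : R :=
  (x^T *m y) 0 0.

(* The norm `|x| that MathComp-Analysis puts on matrices is the sup norm, so
   the Euclidean norm is defined here. *)
Definition norm2 (R : realType) (d : nat) (x : 'cV[R]_d) : R :=
  Num.sqrt (dotv x x).

(* S is an arbitrary set: finiteness of codes is not assumed. *)
Definition spherical_code (R : realType) (d : nat) (alpha beta : R)
    (S : set 'cV[R]_d) : Prop :=
  (forall x, S x -> norm2 x = 1) /\
  (forall x y, S x -> S y -> x <> y -> dotv x y = alpha \/ dotv x y = beta).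

(* [counting S] is the number of elements of S, and +oo when S is infinite.
   The value is +oo exactly when code sizes are unbounded; otherwise it is a
   maximum, see [max_code_size_attained]. *)
Definition max_code_size (R : realType) (alpha beta : R) (d : nat) : \bar R :=
  ereal_sup [set counting S | S in @spherical_code R d alpha beta].

Lemma max_code_size_attained (R : realType) (alpha beta : R) (d : nat) :
  (max_code_size alpha beta d < +oo)%E ->
  exists2 S : set 'cV[R]_d, spherical_code alpha beta S
    & counting S = max_code_size alpha beta d.
Proof.
move=> Nfin.
have N0 : (0 <= max_code_size alpha beta d)%E.
  have <- : counting (set0 : set 'cV[R]_d) = 0%E :> \bar R.
    by rewrite /counting asboolT // fset_set0.
  by apply: ereal_sup_ubound; exists set0 => //; split.
have Nnum : max_code_size alpha beta d \is a fin_num by rewrite ge0_fin_numE.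
have cntle (S : set 'cV[R]_d) : spherical_code alpha beta S ->
    (counting S <= max_code_size alpha beta d)%E.
  by move=> cS; apply: ereal_sup_ubound; exists S.
have cntE (S : set 'cV[R]_d) : spherical_code alpha beta S ->
    exists n : nat, counting S = n%:R%:E :> \bar R.
  move=> /cntle; rewrite /counting; case: ifPn => _; last first.
    by move=> h; have := le_lt_trans h Nfin; rewrite ltxx.
  by move=> _; eexists.
have [_ [S cS <-] ltS] := ub_ereal_sup_adherent (@ltr01 R) Nnum.
exists S => //; apply/eqP; rewrite eq_le cntle//=.
apply: ge_ereal_sup => _ [T cT <-].
have mle := cntle T cT; have [n Sn] := cntE S cS; have [m Tm] := cntE T cT.
rewrite Sn in ltS; rewrite Tm in mle; rewrite Sn Tm lee_fin ler_nat -ltnS.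
rewrite -(ltr_nat R) -natr1 -ltrBlDr -lte_fin EFinB.
by apply: le_lt_trans ltS; apply: leeB.
Qed.

(* Main.v *)
(* The Gram matrix of a code shifted by [- beta] is
   [(alpha - beta) (mu I + A)], where [mu = (1 - beta) / (alpha - beta)] and [A]
   is the adjacency matrix of the graph of pairs with inner product [alpha].
   A graph on [m] vertices has least eigenvalue at least
   [- sqrt (floor (m / 2) * ceil (m / 2))], so under the gap hypothesis any
   [m = d + 2 - k] points are affinely independent.  Moreover, given a code
   with [2 ^ k * m] points, fix one of them: at least [2 ^ (k - 1) * m] of the
   others have the same inner product [t < 1] with it, and it is not in their
   affine span.  Iterating [k] times gives [m + k = d + 2] dimensions in the
   linearized affine space of dimension [d + 1]. *)
Require Import Defs.
From mathcomp Require Import all_boot all_order all_algebra.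
From mathcomp Require Import all_classical all_reals all_analysis.
From mathcomp Require Import ring lra zify.
Import Order.TTheory GRing.Theory Num.Theory.
Local Open Scope ring_scope.

(** Cauchy-Schwarz against the all-ones vector, read off from the expansion of the sum of the
    squares [(#|P|%:R * a i - A) ^+ 2]. *)
Lemma sqr_sum_le_card (R : realType) (I : finType) (P : pred I) (a : I -> R) :
  (\sum_(i | P i) a i) ^+ 2 <= #|P|%:R * \sum_(i | P i) a i ^+ 2.
Proof.
set A := \sum_(i | P i) a i; set Q := \sum_(i | P i) a i ^+ 2.
have c0 : 0 <= #|P|%:R :> R by rewrite ler0n.
have : 0 <= \sum_(i | P i) (#|P|%:R * a i - A) ^+ 2.
  by apply: sumr_ge0 => i _; rewrite sqr_ge0.
have -> : \sum_(i | P i) (#|P|%:R * a i - A) ^+ 2 =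
   #|P|%:R * (#|P|%:R * Q - A ^+ 2).
  have E i : (#|P|%:R * a i - A) ^+ 2 =
      #|P|%:R ^+ 2 * a i ^+ 2 + (- (2 * #|P|%:R * A)) * a i + A ^+ 2 by ring.
  under eq_bigr do rewrite E.
  rewrite !big_split /= sumr_const -!mulr_sumr -/A -/Q -[_ *+ #|P|]mulr_natl.
  by ring.
have [P0 _|P0] := eqVneq #|P| 0%N; last first.
  by rewrite pmulr_rge0 ?subr_ge0 // lt0r c0 pnatr_eq0 P0.
by rewrite /A big_pred0 ?P0 ?expr0n ?mul0r // => i; exact: (card0_eq P0 i).
Qed.

Lemma mul_le_half_uphalf (p q n : nat) :
  (p + q <= n)%N -> (p * q <= n./2 * uphalf n)%N.
Proof.
wlog pq : p q / (p <= q)%N => [H pqn|pqn].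
  case: (leqP p q) => [|/ltnW] pq; first exact: H.
  by rewrite mulnC; apply: H; rewrite 1?addnC.
have nE := odd_double_half n; rewrite uphalf_half.
have pn : (p <= n./2)%N by lia.
(* The product [p * (n - p)] grows with [p] up to [n./2]. *)
apply: (@leq_trans (p * (n - p))); first by rewrite leq_mul2l; lia.
have -> : (n - p = odd n + n./2 + (n./2 - p))%N by lia.
nia.
Qed.

(* The negative terms of the quadratic form are products of a positive and a
   negative coordinate, so the extremal graph is complete bipartite, with least
   eigenvalue [- sqrt (p * q)] for parts of sizes [p] and [q]. *)
Lemma graph_form_ge (R : realType) (I : finType) (e : rel I) (a : I -> R) :
  - (Num.sqrt (#|I|./2 * uphalf #|I|)%N%:R * \sum_i a i ^+ 2) <=
  \sum_i \sum_(j | e i j) a i * a j.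
Proof.
set s := Num.sqrt _.
pose P := [pred i | 0 <= a i].
pose N := [predC P].
set p := \sum_(i | P i) a i; set q := \sum_(i | N i) a i.
set p2 := \sum_(i | P i) a i ^+ 2; set q2 := \sum_(i | N i) a i ^+ 2.
have sq : \sum_i a i ^+ 2 = p2 + q2 by rewrite (bigID P).
have p0 : 0 <= p by apply: sumr_ge0.
have q0 : q <= 0.
  by apply: sumr_le0 => i; rewrite /= -ltNge => /ltW.
have p20 : 0 <= p2 by apply: sumr_ge0 => i _; exact: sqr_ge0.
have q20 : 0 <= q2 by apply: sumr_ge0 => i _; exact: sqr_ge0.
have s0 : 0 <= s by exact: sqrtr_ge0.
(* Pairs of opposite sign contribute [2 * (p * q)] in total. Any other [e] only omits nonpositive
   products or adds nonnegative ones. *)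
have bip : 2 * (p * q) <= \sum_i \sum_(j | e i j) a i * a j.
  have -> : 2 * (p * q) = \sum_i \sum_(j | P i != P j) a i * a j.
    rewrite mulr_natl mulr2n [in RHS](bigID P) /=; congr (_ + _).
      rewrite mulr_suml; apply: eq_bigr => i /= Pi; rewrite mulr_sumr.
      by apply: eq_bigl => j; rewrite /= Pi ?inE; case: (0 <= a j).
    rewrite mulrC mulr_suml; apply: eq_bigr => i; rewrite !inE => /negbTE Pi.
    rewrite mulr_sumr.
    by apply: eq_bigl => j; rewrite /= Pi ?inE; case: (0 <= a j).
  apply: ler_sum => i _; rewrite big_mkcond [leRHS]big_mkcond.
  apply: ler_sum => j _ /=.
  case: (leP 0 (a i)) (leP 0 (a j)) => [ai|ai] [aj|aj] /=;
    case: (e i j) => //; nra.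
have : (p * q) ^+ 2 <= s ^+ 2 * (p2 * q2).
  have hp := sqr_sum_le_card R I P a; have hq := sqr_sum_le_card R I N a.
  rewrite -/p -/p2 in hp; rewrite -/q -/q2 in hq.
  rewrite exprMn sqr_sqrtr ?ler0n //.
  apply: le_trans (ler_pM (sqr_ge0 _) (sqr_ge0 _) hp hq) _.
  rewrite mulrACA ler_wpM2r ?mulr_ge0 // -natrM ler_nat.
  by apply: mul_le_half_uphalf; rewrite cardC.
move=> pq; rewrite sq; apply: le_trans bip.
rewrite lerNl -mulrN.
rewrite -(@ler_pXn2r _ 2) // ?nnegrE; [|nra|nra].
(* AM-GM in the form [4 * (p2 * q2) <= (p2 + q2) ^+ 2], scaled by [s ^+ 2]. *)
have : 0 <= s ^+ 2 * (p2 - q2) ^+ 2 by rewrite mulr_ge0 ?sqr_ge0.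
nra.
Qed.

(* Linear independence of the lifts is affine independence of the points. *)
Definition lift_affine {R : realType} {d : nat} (x : 'cV[R]_d) :
    'cV[R]_(d + 1) :=
  col_mx x 1%:M.

Lemma code_dot_self (R : realType) (d : nat) (alpha beta : R)
    (S : set 'cV[R]_d) x :
  spherical_code alpha beta S -> S x -> dotv x x = 1.
Proof.
move=> codeS /codeS.1 /(congr1 (fun r => r ^+ 2)); rewrite /norm2 expr1n.
(* [Num.sqrt] is 0 on negative arguments, which norm 1 rules out. *)
case: (leP 0 (dotv x x)) => [/sqr_sqrtr -> //|/ltW/ler0_sqrtr ->].
by rewrite expr0n => /eqP; rewrite eq_sym oner_eq0.
Qed.

Lemma dotv_sum (R : realType) (d : nat) (I : finType) (a : I -> R)
    (x : I -> 'cV[R]_d) :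
  dotv (\sum_i a i *: x i) (\sum_i a i *: x i) =
  \sum_i \sum_j a i * a j * dotv (x i) (x j).
Proof.
have -> : dotv (\sum_i a i *: x i) (\sum_i a i *: x i) =
    ((\sum_i a i *: (x i)^T) *m (\sum_i a i *: x i)) 0 0.
  rewrite /dotv [X in X *m _](_ : _ = \sum_i a i *: (x i)^T) // raddf_sum.
  by apply: eq_bigr => i _; rewrite /= linearZ.
rewrite mulmx_suml summxE; apply: eq_bigr => i _.
rewrite mulmx_sumr summxE; apply: eq_bigr => j _.
by rewrite -scalemxAl -scalemxAr scalerA mxE.
Qed.

(** A dependency among the lifts satisfies both [\sum_i a i *: x i = 0] and [\sum_i a i = 0]. The
    first makes the Gram form vanish at [a], the second removes its [beta] term, and the gap makes
    the rest positive definite. *)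
Lemma free_lift_affine (R : realType) (d : nat) (alpha beta : R)
    (S : set 'cV[R]_d) (s : seq 'cV[R]_d) :
  beta < alpha -> spherical_code alpha beta S ->
  uniq s -> (forall x, x \in s -> S x) ->
  Num.sqrt ((size s)./2 * uphalf (size s))%N%:R < (1 - beta) / (alpha - beta) ->
  free (map lift_affine s).
Proof.
move=> hba codeS us sS gap.
pose x (i : 'I_(size s)) := s`_i.
have -> : map lift_affine s = [tuple lift_affine (x i) | i < size s].
  apply: (@eq_from_nth _ 0) => [|i]; first by rewrite size_map size_tuple.
  rewrite size_map => lis.
  by rewrite (nth_map 0) // -[i]/(val (Ordinal lis)) -tnth_nth tnth_mktuple.
apply/freeP => a; under eq_bigr do rewrite -tnth_nth tnth_mktuple.
move=> az.
have xz : \sum_i a i *: x i = 0.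
  have := congr1 usubmx az; rewrite linear_sum linear0 /= => usz.
  rewrite -[RHS]usz.
  by apply: eq_bigr => i _; rewrite linearZ /= col_mxKu.
have a0 : \sum_i a i = 0.
  have := congr1 (fun z => dsubmx z 0 0) az.
  rewrite linear_sum linear0 /= summxE mxE => dsz; rewrite -[RHS]dsz.
  by apply: eq_bigr => i _; rewrite linearZ /= col_mxKd !mxE mulr1.
pose e := [rel i j | (i != j) && (dotv (x i) (x j) == alpha)].
have xx i j : dotv (x i) (x j) =
    beta + (1 - beta) *+ (i == j) + (alpha - beta) *+ e i j.
  have Sx l : S (x l) by apply: sS; rewrite mem_nth.
  rewrite /=; case: eqVneq => [->|ij] /=.
    by rewrite (code_dot_self _ _ _ _ _ _ codeS) // mulr1n mulr0n; ring.
  have xij : x i <> x j.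
    move=> /eqP; rewrite nth_uniq // => /eqP/val_inj/eqP.
    by rewrite (negbTE ij).
  case: (codeS.2 _ _ (Sx i) (Sx j) xij) => ->.
    by rewrite eqxx mulr1n mulr0n; ring.
  by rewrite lt_eqF // !mulr0n; ring.
have q0 : (1 - beta) * (\sum_i a i ^+ 2) +
    (alpha - beta) * (\sum_i \sum_(j | e i j) a i * a j) = 0.
  have := dotv_sum R d _ a x; rewrite xz {1}/dotv mulmx0 mxE => dz.
  rewrite [RHS]dz.
  transitivity (\sum_i (beta * a i * (\sum_j a j) + (1 - beta) * a i ^+ 2 +
      (alpha - beta) * \sum_(j | e i j) a i * a j)).
    rewrite !big_split /= -!mulr_sumr a0.
    rewrite [X in _ = X + _ + _]big1 ?add0r // => i _.
    by rewrite mulr0.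
  apply: eq_bigr => i _.
  have -> : a i ^+ 2 = \sum_(j | j == i) a i * a j.
    by rewrite big_pred1_eq expr2.
  rewrite !mulr_sumr big_mkcond [X in _ + X + _]big_mkcond.
  rewrite [X in _ + X]big_mkcond.
  rewrite -!big_split /=.
  apply: eq_bigr => j _; rewrite [in RHS]xx [j == i]eq_sym /=.
  have [->|ij] := eqVneq i j; rewrite ?eqxx /=; first by rewrite mulr0n; ring.
  by case: ifP => _; rewrite ?mulr1n ?mulr0n; ring.
have ge := graph_form_ge R _ e a; rewrite card_ord in ge.
set s2 := \sum_i a i ^+ 2 in q0 ge.
have s20 : s2 = 0.
  apply/eqP; rewrite eq_le sumr_ge0 ?andbT; last by move=> i _; exact: sqr_ge0.
  have ab : 0 < alpha - beta by rewrite subr_gt0.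
  move: gap; rewrite ltr_pdivlMr // => gap.
  rewrite leNgt; apply/negP => s2p.
  set r := Num.sqrt _ in gap ge; set f := \sum_i _ in q0 ge.
  have := ler_wpM2l (ltW ab) ge.
  have : 0 < (1 - beta - r * (alpha - beta)) * s2.
    by rewrite mulr_gt0 ?subr_gt0.
  by nra.
move=> i; apply/eqP; rewrite -sqrf_eq0.
have := psumr_eq0P (fun i _ => sqr_ge0 (a i)) s20.
by move=> ->.
Qed.

(* An affine combination of points having inner product [t] with [v] has inner
   product [t] with [v]. *)
Lemma lift_affine_notin_span (R : realType) (d : nat) (t : R) (v : 'cV[R]_d)
    (W : seq 'cV[R]_d) :
  (forall w, w \in W -> dotv v w = t) -> dotv v v != t ->
  lift_affine v \notin <<map lift_affine W>>%VS.
Proof.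
move=> Wt vt.
(* This linear form vanishes on the lifts of [W] but not on that of [v]. *)
pose g : 'Hom('cV[R]_(d + 1), 'cV[R]_1) := linfun (mulmx (row_mx v^T (- t)%:M)).
have gE w : g (lift_affine w) = (dotv v w - t)%:M.
  rewrite lfunE /= mul_row_col mulmx1; apply/matrixP => i j.
  by rewrite !ord1 !mxE eqxx !mulr1n /dotv mxE.
apply: contra vt => vW; rewrite -subr_eq0.
have /subvP/(_ _ vW) : (<<map lift_affine W>>%VS <= lker g)%VS.
  apply/span_subvP => _ /mapP[w wW ->].
  by rewrite memv_ker gE Wt // subrr ?raddf0.
rewrite memv_ker gE => /eqP/matrixP/(_ 0 0).
by rewrite !mxE eqxx mulr1n => ->.
Qed.

Lemma dim_span_lift_ge (R : realType) (d : nat) (alpha beta : R)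
    (S : set 'cV[R]_d) (m k : nat) (s : seq 'cV[R]_d) :
  beta < alpha -> alpha < 1 -> spherical_code alpha beta S ->
  Num.sqrt (m./2 * uphalf m)%N%:R < (1 - beta) / (alpha - beta) ->
  (0 < m)%N -> uniq s -> (forall x, x \in s -> S x) ->
  (2 ^ k * m <= size s)%N ->
  (m + k <= \dim <<map lift_affine s>>)%N.
Proof.
move=> hba halpha codeS gap m0.
elim: k s => [|k IH] s us sS ms.
  rewrite mul1n in ms; rewrite addn0.
  have st : size (take m s) = m by rewrite size_takel.
  have : free (map lift_affine (take m s)).
    apply: (free_lift_affine _ _ alpha beta S); rewrite ?st ?take_uniq //.
    by move=> x /mem_take; exact: sS.
  rewrite /free size_map st => /eqP <-.
  by apply: dimvS; apply: sub_span => x /mapP[y /mem_take ys ->]; exact: map_f.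
case: s us sS ms => [|v s] /=; first by lia.
move=> /andP[vs us] sS ms.
pose p w := dotv v w == alpha.
have [t [q [qt t1 qs]]] : exists t (q : pred 'cV[R]_d),
    [/\ forall w, w \in seq.filter q s -> dotv v w = t, t < 1
       & (2 ^ k * m <= size (seq.filter q s))%N].
  (* Without [v] at least [2 * (2 ^ k * m) - 1] points remain, so one of the two classes still has
     [2 ^ k * m] of them. *)
  have [le|lt] := leqP (2 ^ k * m) (size (seq.filter p s)).
    by exists alpha, p; split => // w; rewrite mem_filter => /andP[/eqP].
  exists beta, (predC p); split; last 2 first.
  - exact: lt_trans halpha.
  - have := count_predC p s; rewrite -!size_filter.
    by move: ms lt; rewrite expnS -mulnA; lia.
  - move=> w; rewrite mem_filter => /andP[/eqP va ws].
    have vw : v <> w by move=> vw; rewrite vw ws in vs.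
    have [] := codeS.2 v w _ _ vw => //; apply: sS; rewrite ?mem_head //.
    by rewrite inE ws orbT.
have Sv : S v by apply: sS; rewrite mem_head.
have nv := lift_affine_notin_span _ _ t v _ qt.
rewrite (code_dot_self _ _ _ _ _ _ codeS Sv) gt_eqF // in nv.
have {}IH : (m + k <= \dim <<map lift_affine (seq.filter q s)>>)%N.
  apply: IH => //; first exact: filter_uniq.
  move=> x; rewrite mem_filter => /andP[_ xs].
  by apply: sS; rewrite inE xs orbT.
rewrite addnS; apply: leq_ltn_trans IH _.
rewrite ltn_neqAle; apply/andP; split; last first.
  apply: dimvS; apply: sub_span => x /mapP[y].
  rewrite mem_filter => /andP[_ ys] ->.
  by rewrite inE map_f ?orbT.
(* Equal dimensions would make the nested spans equal, putting the lift of [v] in the smaller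
   one. *)
apply: contra (nv isT) => /eqP eqd.
have : (<<map lift_affine (seq.filter q s)>> ==
        <<lift_affine v :: map lift_affine s>>)%VS.
  rewrite eqEdim eqd leqnn andbT.
  apply: sub_span => x /mapP[y]; rewrite mem_filter => /andP[_ ys] ->.
  by rewrite inE map_f ?orbT.
by move=> /eqP ->; apply: memv_span; rewrite mem_head.
Qed.

Theorem theorem5p4 (R : realType) (d : nat) (alpha beta : R) (k : nat)
    (hd : (0 < d)%N)
    (hbeta : -1 <= beta) (hba : beta < alpha) (halpha : alpha < 1)
    (hbeta0 : beta < 0)
    (hk : (k <= d + 1)%N)
    (hgap : (1 - beta) / (alpha - beta) >
       Num.sqrt (((d + 2 - k)./2 * uphalf (d + 2 - k))%N%:R : R)) :
  (max_code_size alpha beta d <= (2 ^ k * (d + 2 - k) - 1)%N%:R%:E)%E.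
Proof.
have m0 : (0 < d + 2 - k)%N by lia.
apply: ge_ereal_sup => _ [S codeS <-].
have bound (s : seq 'cV[R]_d) : uniq s -> (forall x, x \in s -> S x) ->
    (size s <= 2 ^ k * (d + 2 - k) - 1)%N.
  move=> us sS; rewrite leqNgt; apply/negP => ns.
  have ms : (2 ^ k * (d + 2 - k) <= size s)%N by lia.
  (* The span would have dimension at least [d + 2] inside a space of dimension [d + 1]. *)
  have := dim_span_lift_ge _ _ _ _ S _ k s hba halpha codeS hgap m0 us sS ms.
  have := dimvS (subvf <<map lift_affine s>>%VS).
  rewrite dimvf /dim /= muln1; lia.
have [Sfin|Sinf] := pselect (finite_set S).
  rewrite /counting asboolT // lee_fin ler_nat; apply: bound.
    exact: finmap.fset_uniq.
  by move=> x; rewrite in_fset_set // inE.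
have [B BS Bn] := infinite_set_fset (2 ^ k * (d + 2 - k)) Sinf.
have le := bound (finmap.enum_fset B) (finmap.fset_uniq B) BS.
(* Positivity makes the truncated [- 1] a strict decrease, so the finite subset [B] contradicts
   [bound]. *)
have : (0 < 2 ^ k * (d + 2 - k))%N by rewrite muln_gt0 expn_gt0 m0.
by have := leq_trans Bn le; lia.
Qed.
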